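(* Let $T$ be a connected $\mathbb{Z}^d$-tile and $G_n=(V_n,E_n)$ ($n\in\mathbb{N}$) its associated Hata graphs. Let $n_0$ be a positive integer. Suppose that for each $n\ge n_0$ there is a partition $V_n=W_1^{(n)}\cup W_2^{(n)}\cup W_3^{(n)}$ with $W_j^{(n)}\neq\emptyset$ ($j\in\{1,2,3\}$) such that the following properties hold. (i) For all $n\ge n_0$, the set $W_2^{(n)}$ induces a connected subgraph of $G_n$ and separates $G_n$ between $W_1^{(n)}$ and $W_3^{(n)}$. (ii) For all $n\ge n_0$, the inclusions $$W_1^{(n+1)}\subset C(W_1^{(n)})\cup C(W_2^{(n)}),\qquad W_2^{(n+1)}\subset C(W_2^{(n)}),\qquad W_3^{(n+1)}\subset C(W_3^{(n)})\cup C(W_2^{(n)})$$ hold. (iii) The number of elements of $W_2^{(n)}$ is uniformly bounded, i.e., there is an integer $K$ such that $\#W_2^{(n)}\le K$ for all $n\geq n_0$. Then $\bigcap_{n\ge n_0}X_n(W_2^{(n)})$ consists of a single point and this point is a cut point of $T$.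
   Context: A $\mathbb{Z}^d$-tile (integral self-affine $\mathbb{Z}^d$-tile with standard digit set) $T=T(A,\mathcal{D})\subset\mathbb{R}^d$ is given by a $d\times d$ integer matrix $A$ all of whose eigenvalues are greater than $1$ in modulus and a complete set $\mathcal{D}\subset\mathbb{Z}^d$ of coset representatives of $\mathbb{Z}^d/A\mathbb{Z}^d$ (so $|\mathcal{D}|=|\det A|$); $T$ is the unique nonempty compact set with $AT=T+\mathcal{D}=\bigcup_{e\in\mathcal{D}}(T+e)$. It is assumed that $T$ has nonempty interior and that $T+\mathbb{Z}^d$ is a tiling of $\mathbb{R}^d$: $\mathbb{R}^d=T+\mathbb{Z}^d$ and $\mathrm{int}(T+d_1)\cap(T+d_2)=\emptyset$ for all $d_1\ne d_2$ in $\mathbb{Z}^d$. For $n\ge1$, the $n$-th Hata graph $G_n=(V_n,E_n)$ of $T$ has vertex set $V_n=\{\sum_{k=0}^{n-1}A^kd_k : d_k\in\mathcal{D}\}\subset\mathbb{Z}^d$, and there is an edge between $v$ and $v'$ if and only if $(T+v)\cap(T+v')\neq\emptyset$. For $U\subseteq V_n$, the set of children of $U$ is $C(U):=AU+\mathcal{D}=\{v'\in V_{n+1} : \exists v\in U,\ A^{-n-1}(T+v')\subset A^{-n}(T+v)\}\subseteq V_{n+1}$. For $W\subseteq V_n$ put $X_n(W):=\bigcup_{v\in W}A^{-n}(T+v)$. For a partition (into pairwise disjoint sets) $V_n=W_1\cup W_2\cup W_3$, ''$W_2$ separates $G_n$ between $W_1$ and $W_3$'' means that every path in $G_n$ between a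 node of $W_1$ and a node of $W_3$ passes through a node of $W_2$. A cut point of a connected set $Y$ is a point $x\in Y$ such that $Y\setminus\{x\}$ is disconnected. *)

(* Defs.v *)
From mathcomp Require Import all_boot all_order all_algebra.
From mathcomp Require Import complex.
From mathcomp Require Import all_classical all_reals all_analysis.

Set Implicit Arguments.
Unset Strict Implicit.
Unset Printing Implicit Defensive.

Import Order.TTheory GRing.Theory Num.Theory.
Import numFieldNormedType.Exports.

Local Open Scope classical_set_scope.
Local Open Scope ring_scope.

Section Tiles.
Variables (R : realType) (d : nat).
Implicit Types (A : 'M[int]_d) (D U W : set 'cV[int]_d) (T : set 'cV[R]_d).

Definition expanding A : Prop :=
  forall l : R[i], eigenvalue (map_mx intr A : 'M[R[i]]_d) l -> 1 < `|l|.

Definition complete_residues A D : Prop :=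
  forall z : 'cV[int]_d, exists! e, D e /\ exists y, z = e + A *m y.

Definition translate T (v : 'cV[int]_d) : set 'cV[R]_d :=
  [set x + map_mx intr v | x in T].

Definition linear_image (M : 'M[R]_d) T : set 'cV[R]_d := [set M *m x | x in T].

(* [tile_eqn] determines T among nonempty compact sets, by Hutchinson's
   theorem, so T is a parameter rather than a construction. *)
Record Zd_tile A D T : Prop := {
  tile_expanding : expanding A;
  tile_digits : complete_residues A D;
  tile_nonempty : T !=set0;
  tile_compact : compact T;
  tile_eqn : linear_image (map_mx intr A) T = \bigcup_(e in D) translate T e;
  tile_interior : interior T !=set0;
  tile_cover : \bigcup_(z in [set: 'cV[int]_d]) translate T z = [set: 'cV[R]_d];
  tile_disjoint : forall z1 z2 : 'cV[int]_d, z1 <> z2 ->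
    interior (translate T z1) `&` translate T z2 = set0
}.

Definition hata_vertices A D (n : nat) : set 'cV[int]_d :=
  [set v | exists2 dg : 'I_n -> 'cV[int]_d,
     (forall k, D (dg k)) & v = \sum_(k < n) A ^+ k *m dg k].

(* Loops are allowed: they affect neither connectedness nor separation. *)
Definition hata_edge A D T (n : nat) : rel 'cV[int]_d := fun v w =>
  `[< [/\ hata_vertices A D n v, hata_vertices A D n w
        & translate T v `&` translate T w !=set0] >].

Definition induces_connected (e : rel 'cV[int]_d) W : Prop :=
  forall u v, W u -> W v ->
  exists2 p, path (fun x y => [&& `[< W x >], `[< W y >] & e x y]) u p
           & last u p = v.

Definition separates (e : rel 'cV[int]_d) W2 W1 W3 : Prop :=
  forall u p, path e u p -> W1 u -> W3 (last u p) ->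
  exists2 w, w \in u :: p & W2 w.

Definition children A D U : set 'cV[int]_d :=
  [set A *m u + e | u in U & e in D].

Definition tile_union A T (n : nat) W : set 'cV[R]_d :=
  \bigcup_(v in W) linear_image (invmx (map_mx intr A ^+ n)) (translate T v).

Definition partition3 (V W1 W2 W3 : set 'cV[int]_d) : Prop :=
  [/\ V = W1 `|` W2 `|` W3,
      W1 `&` W2 = set0, W1 `&` W3 = set0 & W2 `&` W3 = set0].

End Tiles.

Definition cut_point (X : topologicalType) (Y : set X) (x : X) : Prop :=
  Y x /\ ~ connected (Y `\ x).

(* Main.v *)
(* Write X_n(W) for the union of the A^-n (T + v), v in W.  Since
   X_(n+1)(C(U)) = X_n(U), the sets X_n(W2) decrease; each is a chain of at most
   K pieces whose diameters tend to 0, because Cayley-Hamilton over the complex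
   numbers gives |A^-n| <= c r^n with r < 1.  So they shrink to a point x.
   The sets X_n(W1) and X_n(W3) are disjoint by separation, and a point of
   X_n(W1) outside X_n(W2) stays in X_m(W1) outside X_m(W2) for all m >= n.
   Hence T minus x is the disjoint union of the relatively open sets
   U_n X_n(W1) \ X_n(W2) and U_n X_n(W3) \ X_n(W2).  Both are nonempty: an
   interior point of a tile lies in no other tile. *)

Require Import Defs.
From mathcomp Require Import all_boot all_order all_algebra.
From mathcomp Require Import complex.
From mathcomp Require Import all_classical all_reals all_analysis.
Set Implicit Arguments.
Unset Strict Implicit.
Unset Printing Implicit Defensive.
Import Order.TTheory GRing.Theory Num.Theory.
Import numFieldNormedType.Exports.
Local Open Scope classical_set_scope.
Local Open Scope card_scope.
Local Open Scope ring_scope.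

(** * Powers of the inverse of an expanding matrix *)

(* [B^(k+1) Q = z^-1 (B^k Q - B^(k+1) (A - z) Q)], so a geometric bound of ratio
   [r > |z|^-1] survives the removal of the factor [A - z]. *)
Lemma power_bound_factor (C : numClosedFieldType) n (A B Q : 'M[C]_n.+1)
    (z r c : C) :
  B * A = 1 -> 1 < `|z| -> `|z|^-1 < r ->
  (forall k, `|B ^+ k * ((A - z%:M) * Q)| <= c * r ^+ k) ->
  exists c', forall k, `|B ^+ k * Q| <= c' * r ^+ k.
Proof.
move=> BA z1 zr Hc.
have z0 : 0 < `|z| by apply: lt_trans z1.
have zn0 : z != 0 by rewrite -normr_gt0.
have r0 : 0 < r by apply: lt_trans zr; rewrite invr_gt0.
have c0 : 0 <= c by have := Hc 0; rewrite expr0 mulr1; apply: le_trans.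
have s0 : 0 < r - `|z|^-1 by rewrite subr_gt0.
(* The second summand solves [|z|^-1 * (c' + c * r) = c' * r] for [c'], the requirement of the
   inductive step; adding [|Q|] covers [k = 0]. *)
pose c' := `|Q| + `|z|^-1 * (c * r) / (r - `|z|^-1).
exists c'; elim=> [|k IH].
  rewrite expr0 mul1r mulr1 lerDl.
  apply: mulr_ge0; last by rewrite invr_ge0 ltW.
  by rewrite mulr_ge0 ?invr_ge0 ?mulr_ge0 // ltW.
have -> : B ^+ k.+1 * Q = z^-1 *: (B ^+ k * Q - B ^+ k.+1 * ((A - z%:M) * Q)).
  have -> : B ^+ k.+1 * ((A - z%:M) * Q) = B ^+ k * Q - z *: (B ^+ k.+1 * Q).
    rewrite mulrBl mulrBr mulrA exprSr -(mulrA _ B A) BA mulr1.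
    by rewrite -[z%:M * Q]/(z%:M *m Q) mul_scalar_mx -scalerAr.
  by rewrite opprB addrC subrK scalerA mulVf // scale1r.
rewrite normrZ normfV.
apply: (@le_trans _ _ (`|z|^-1 * (c' * r ^+ k + c * r ^+ k.+1))).
  rewrite ler_pM2l ?invr_gt0 //; apply: le_trans (ler_normB _ _) _.
  exact: lerD.
rewrite exprS !mulrA -!mulrDl mulrA.
rewrite ler_wpM2r ?exprn_ge0 ?(ltW r0) // mulrDr.
rewrite -lerBrDl [_ * c']mulrC -mulrBr /c' mulrDl divfK ?gt_eqF //.
by rewrite lerDr mulr_ge0 // ltW.
Qed.

(** Each use of [power_bound_factor] strips the leading factor, with the rest of the product counted
    into its [Q]; the ratio [r] is kept and only the constant changes. *)
Lemma power_bound_prod (C : numClosedFieldType) n (A B : 'M[C]_n.+1)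
    (s : seq C) (r : C) :
  B * A = 1 ->
  (forall z, z \in s -> 1 < `|z| /\ `|z|^-1 < r) ->
  forall Q, (exists c, forall k,
     `|B ^+ k * (\prod_(z <- s) (A - z%:M) * Q)| <= c * r ^+ k) ->
  exists c, forall k, `|B ^+ k * Q| <= c * r ^+ k.
Proof.
move=> BA; elim: s => [|z s IH] zs Q [c Hc].
  by exists c => k; move: (Hc k); rewrite big_nil mul1r.
have [z1 zr] := zs z (mem_head _ _).
apply: IH => [y ys|]; first by apply: zs; rewrite in_cons ys orbT.
apply: (power_bound_factor BA z1 zr (c := c)) => k.
by move: (Hc k); rewrite big_cons -(mulrA (A - z%:M)).
Qed.

Lemma common_inverse_bound (C : numClosedFieldType) (s : seq C) :
  (forall z, z \in s -> 1 < `|z|) ->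
  exists r, [/\ 0 < r, r < 1 & forall z, z \in s -> `|z|^-1 < r].
Proof.
elim: s => [|z s IH] zs.
  exists (2^-1); split=> [||z]; rewrite ?invr_gt0 ?invf_lt1 ?ltr1n ?ltr0n //.
have [r [r0 r1 sr]] : exists r,
    [/\ 0 < r, r < 1 & forall z, z \in s -> `|z|^-1 < r].
  by apply: IH => y ys; apply: zs; rewrite in_cons ys orbT.
have z1 := zs z (mem_head _ _).
have q1 : `|z|^-1 < 1 by rewrite invf_lt1 // (lt_trans _ z1).
have p0 : 0 < (1 - r) * (1 - `|z|^-1) by rewrite mulr_gt0 ?subr_gt0.
(* A substitute for the maximum of [r] and [|z|^-1], the order of [C] being partial: the value
   equals [r + |z|^-1 * (1 - r)], and is symmetric in the two. *)
exists (1 - (1 - r) * (1 - `|z|^-1)); split.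
- rewrite subr_gt0 mulr_ilt1 ?subr_ge0 ?gtrBl ?(ltW r1) ?(ltW q1) //.
  by rewrite invr_gt0 (lt_trans _ z1).
- by rewrite gtrBl.
move=> y; rewrite in_cons => /orP[/eqP->|ys].
  by rewrite ltrBrDl -ltrBrDr gtr_pMl ?subr_gt0 // gtrBl.
apply: lt_le_trans (sr y ys) _.
by rewrite lerBrDl -lerBrDr ger_pMr ?subr_gt0 // gerBl invr_ge0.
Qed.

(** The characteristic polynomial splits, so by Cayley-Hamilton the product of all [A - z] is 0 and
    is bounded trivially; stripping its factors leaves the bound for [Q = 1]. *)
Lemma inverse_power_bound (C : numClosedFieldType) n (A B : 'M[C]_n.+1) :
  B * A = 1 -> (forall z, eigenvalue A z -> 1 < `|z|) ->
  exists r, [/\ 0 < r, r < 1 & exists c, forall k, `|B ^+ k| <= c * r ^+ k].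
Proof.
move=> BA ev.
have [s Ds] := closed_field_poly_normal (char_poly A).
rewrite (monicP (char_poly_monic A)) scale1r in Ds.
have s1 z : z \in s -> 1 < `|z|.
  by move=> zs; apply: ev; rewrite eigenvalue_root_char Ds root_prod_XsubC.
have [r [r0 r1 sr]] := common_inverse_bound s1.
exists r; split=> //.
have [|c Hc] := power_bound_prod (s := s) (Q := 1) BA
  (fun z zs => conj (s1 z zs) (sr z zs)).
  exists 0 => k.
  suff -> : \prod_(z <- s) (A - z%:M) = 0 by rewrite mul0r mulr0 normr0 mul0r.
  rewrite -(Cayley_Hamilton A) Ds rmorph_prod.
  by apply: eq_bigr => z _; rewrite rmorphB /= horner_mx_X horner_mx_C.
by exists c => k; move: (Hc k); rewrite mulr1.
Qed.

(** An eigenvalue 0 would contradict expansion, so the kernel over [R[i]] is trivial; invertibility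
    descends to [R] along the field embedding. *)
Lemma expanding_unitmx (R : realType) d (A : 'M[int]_d) :
  expanding R A -> (map_mx intr A : 'M[R]_d) \in unitmx.
Proof.
move=> Aexp; rewrite -(map_unitmx (real_complex R)) -map_mx_comp.
rewrite (eq_map_mx _ (fun x => rmorph_int (real_complex R) x)).
rewrite -row_free_unit -kermx_eq0; apply/negPn/negP => Ak.
have := Aexp 0; rewrite normr0 ltr10 /eigenvalue /eigenspace raddf0 subr0.
by move/(_ Ak).
Qed.

Lemma mx_coord_norm_le (K : numFieldType) m n (M : 'M[K]_(m, n)) i j :
  `|M i j| <= `|M|.
Proof.
rewrite [leRHS]/Num.norm /= mx_normE.
rewrite [leLHS](_ : _ = (`|M (i, j).1 (i, j).2|%:nng)%:num)%R //.
by rewrite [_ <= _]num_le; apply: (le_bigmax _ (fun i => `|M i.1 i.2|%:nng)).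
Qed.

Lemma mulmx_norm_le (R : realType) m n (M : 'M[R]_(m, n)) (x : 'cV[R]_n)
    (c : R) : 0 <= c -> (forall i j, `|M i j| <= c) ->
  `|M *m x| <= n%:R * c * `|x|.
Proof.
move=> c0 Mc.
rewrite [leLHS]/Num.norm /= mx_normrE.
apply: bigmax_le => [|[i j] _ /=]; first by rewrite !mulr_ge0.
rewrite ord1 mxE; apply: le_trans (ler_norm_sum _ _ _) _.
apply: (@le_trans _ _ (\sum_(k < n) c * `|x|)); last first.
  by rewrite sumr_const card_ord -mulrA mulr_natl.
by apply: ler_sum => k _; rewrite normrM ler_pM // mx_coord_norm_le.
Qed.

Lemma mulmx_continuous (R : realType) m n (M : 'M[R]_(m, n)) :
  continuous (fun x : 'cV[R]_n => M *m x).
Proof.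
apply: (@bounded_linear_continuous _ _ _ (mulmx M)); apply/linear_boundedP.
near=> r => x; apply: le_trans (mulmx_norm_le x _ (mx_coord_norm_le M)) _ => //.
by rewrite ler_wpM2r //; near: r; apply: nbhs_pinfty_ge; rewrite num_real.
Unshelve. all: by end_near. Qed.

Lemma real_complex_norm (R : realType) (x : R) :
  `|real_complex R x| = real_complex R `|x|.
Proof. by rewrite normc_def /= expr0n addr0 sqrtr_sqr. Qed.

Lemma unitmxX (F : fieldType) d (M : 'M[F]_d) k :
  M \in unitmx -> M ^+ k \in unitmx.
Proof.
move=> Mu; elim: k => [|k IH]; first by rewrite expr0 unitmx1.
by rewrite exprS -[M * _]/(M *m _) unitmx_mul Mu.
Qed.

(** The eigenvalues are complex, so the estimate is made in [R[i]] and brought back: its [r] and [c]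
    are nonnegative there, hence real. *)
Lemma expanding_contraction (R : realType) d (A : 'M[int]_d) :
  expanding R A ->
  exists r c : R, [/\ 0 < r, r < 1, 0 <= c & forall k (x : 'cV[R]_d),
    `|invmx (map_mx intr A ^+ k) *m x| <= c * r ^+ k * `|x|].
Proof.
move=> Aexp; have Mu := expanding_unitmx Aexp.
(* In dimension 0 all vectors vanish; otherwise the size has the successor form that
   [inverse_power_bound] asks for. *)
case: d A Aexp Mu => [|d] A Aexp Mu.
  exists (2^-1), 0; split=> //; rewrite ?invr_gt0 ?invf_lt1 ?ltr1n ?ltr0n //.
  by move=> k x; rewrite [X in `|X|]flatmx0 normr0 !mul0r.
set M := map_mx intr A in Mu *.
pose MC := map_mx (real_complex R) M.
pose BC := map_mx (real_complex R) (invmx M).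
have MCE : MC = map_mx intr A.
  by apply/matrixP => i j; rewrite !mxE rmorph_int.
have [r [r0 r1 [c Hc]]] : exists r : R[i],
    [/\ 0 < r, r < 1 & exists c, forall k, `|BC ^+ k| <= c * r ^+ k].
  apply: (@inverse_power_bound _ _ MC).
  - by rewrite -[BC * MC]/(BC *m MC) -map_mxM mulVmx // map_mx1.
  - by rewrite MCE.
have /complex_realP[r' Dr] : r \is Num.real by rewrite realE (ltW r0).
have c0 : 0 <= c by have := Hc 0; rewrite mulr1; apply: le_trans.
have /complex_realP[c' Dc] : c \is Num.real by rewrite realE c0.
rewrite Dr Dc in r0 r1 c0 Hc.
rewrite ltcR in r0; rewrite (ltcR _ 1) in r1; rewrite lecR in c0.
exists r', (d.+1%:R * c'); split; rewrite ?mulr_ge0 //.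
move=> k x; rewrite -(mulrA _ c'); apply: mulmx_norm_le => [|i j].
  by rewrite mulr_ge0 ?exprn_ge0 // ltW.
rewrite -lecR rmorphM rmorphXn; apply: le_trans (Hc k).
rewrite -real_complex_norm; apply: le_trans (mx_coord_norm_le _ i j).
rewrite -(rmorphXn (map_mx (real_complex R))) mxE.
by rewrite -[invmx M ^+ k]/(M^-1 ^+ k) exprVn.
Qed.

(** * Cut points and nested compact sets *)

(** The topological half of the argument: [Y1], [Y2], [Y3] stand for the unions of tiles over the
    three vertex classes. *)
Lemma cut_point_of_separation (X : topologicalType) (T : set X) (x : X)
    (n0 : nat) (Y1 Y2 Y3 : nat -> set X) :
  (forall n, (n0 <= n)%N ->
     [/\ T = Y1 n `|` Y2 n `|` Y3 n, Y1 n `&` Y3 n = set0,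
         closed (Y1 n `|` Y2 n) & closed (Y3 n `|` Y2 n)]) ->
  (forall n, (n0 <= n)%N ->
     [/\ Y1 n.+1 `<=` Y1 n `|` Y2 n, Y2 n.+1 `<=` Y2 n
       & Y3 n.+1 `<=` Y3 n `|` Y2 n]) ->
  \bigcap_(n in [set n | (n0 <= n)%N]) Y2 n = [set x] ->
  ~ Y1 n0 `<=` Y2 n0 -> ~ Y3 n0 `<=` Y2 n0 ->
  cut_point T x.
Proof.
move=> Ypart Ystep YI Y12 Y32.
have xY2 n : (n0 <= n)%N -> Y2 n x.
  by move=> hn; have : [set x] x by []; rewrite -YI; apply.
have Tx : T x by have [-> _ _ _] := Ypart n0 (leqnn _); left; right; apply: xY2.
split=> // Tc.
(* A point off [Y2 n] cannot change sides: passing from [Y1 n] to [Y3 n.+1] would require membership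
   in [Y3 n] or [Y2 n]. *)
have side_step n y : (n0 <= n)%N -> T y ->
    (Y1 n y /\ ~ Y2 n y -> Y1 n.+1 y /\ ~ Y2 n.+1 y)
    /\ (Y3 n y /\ ~ Y2 n y -> Y3 n.+1 y /\ ~ Y2 n.+1 y).
  move=> hn Ty; have [TE _ _ _] := Ypart _ (leqW hn); rewrite TE in Ty.
  have [_ Y13 _ _] := Ypart _ hn; have [Y1s Y2s Y3s] := Ystep _ hn.
  have no z : Y1 n z -> Y3 n z -> False.
    by move=> ? ?; have : set0 z by rewrite -Y13.
  split=> -[Yy nY2]; (split; last by move/Y2s); case: Ty => [[|/Y2s]|] //.
    by move/Y3s => [] // /(no _ Yy).
  by move/Y1s => [] // /no/(_ Yy).
have side_mono n m y : (n0 <= n)%N -> T y -> (n <= m)%N ->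
    (Y1 n y /\ ~ Y2 n y -> Y1 m y /\ ~ Y2 m y)
    /\ (Y3 n y /\ ~ Y2 n y -> Y3 m y /\ ~ Y2 m y).
  move=> hn Ty /subnK <-; elim: (m - n)%N => [//|k [IH1 IH3]].
  have [h1 h3] := side_step (k + n)%N y (leq_trans hn (leq_addl _ _)) Ty.
  by split=> [/IH1/h1|/IH3/h3].
have side_disj n m y : (n0 <= n)%N -> (n0 <= m)%N -> T y ->
    Y1 n y /\ ~ Y2 n y -> ~ (Y3 m y /\ ~ Y2 m y).
  move=> hn hm Ty /(proj1 (side_mono _ _ _ hn Ty (leq_maxl n m)))[h1 _].
  move=> /(proj2 (side_mono _ _ _ hm Ty (leq_maxr n m)))[h3 _].
  have [_ Y13 _ _] := Ypart _ (leq_trans hn (leq_maxl n m)).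
  by have : set0 y by rewrite -Y13.
have offx n y : (n0 <= n)%N -> ~ Y2 n y -> y <> x.
  by move=> hn ny2 yx; apply: ny2; rewrite yx; apply: xY2.
have escape y : y <> x -> exists2 n, (n0 <= n)%N & ~ Y2 n y.
  move=> yx; apply: contrapT => ne; apply: yx.
  suff : [set x] y by [].
  by rewrite -YI => n hn; apply: contrapT => ?; apply: ne; exists n.
(* [P] is the set of points of [Y1 n] off [Y2 n] for some (equivalently, every
   large) [n]; it is open as written and closed by [PE]. *)
pose V j := \bigcup_(n in [set n | (n0 <= n)%N]) ~` (j n `|` Y2 n).
have Vopen j : (forall n, (n0 <= n)%N -> closed (j n `|` Y2 n)) -> open (V j).
  by move=> jc; apply: bigcup_open => n hn; rewrite openC; apply: jc.
pose P := (T `\ x) `&` V Y3.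
have PE : P = (T `\ x) `&` ~` V Y1.
  apply/seteqP; split=> y [[Ty yx]].
    move=> [n hn /not_orP[n3 n2]]; split=> // -[m hm /not_orP[m1 m2]].
    have : Y1 n y /\ ~ Y2 n y.
      split=> //; have [TE _ _ _] := Ypart n hn.
      by move: Ty; rewrite TE => -[[|]|].
    move/(side_disj _ _ _ hn hm Ty); apply; split=> //.
    by have [TE _ _ _] := Ypart m hm; move: Ty; rewrite TE => -[[|]|].
  move=> nV; split=> //; have [n hn n2] := escape y yx.
  exists n => // -[n3|//]; apply: nV; exists n => // -[n1|//].
  by have [_ Y13 _ _] := Ypart n hn; have : set0 y by rewrite -Y13.
have [y [Y1y nY2y]] := nonsubset Y12.
have [z [Y3z nY2z]] := nonsubset Y32.
have [TE Y13 _ _] := Ypart n0 (leqnn _).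
have Ty : T y by rewrite TE; left; left.
have Tz : T z by rewrite TE; right.
(* Connectedness forces the nonempty clopen [P] to be everything, although [z] lies on the [Y3]
   side. *)
have : P = T `\ x.
  apply: Tc.
  - exists y; split; first by split=> //; apply: (offx n0).
    by exists n0 => //= -[Y3y|//]; have : set0 y by rewrite -Y13.
  - exists (V Y3) => //; apply: Vopen => n hn.
    by case: (Ypart n hn).
  - exists (~` V Y1) => //; rewrite closedC; apply: Vopen => n hn.
    by case: (Ypart n hn).
move=> PT; have [_ [n hn /not_orP[n3 n2]]] : P z.
  by rewrite PT; split=> //; apply: (offx n0).
apply: (side_disj n n0 z) => //; split=> //.
by have [TEn _ _ _] := Ypart n hn; move: Tz; rewrite TEn => -[[|]|].
Qed.

(** Cantor's intersection argument: points chosen in the successive sets cluster in [T] by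
    compactness, every closed [Y n] contains the cluster point, and small diameters exclude a second
    point. *)
Lemma nested_compact_singleton (R : realType) (V : normedModType R)
    (T : set V) (n0 : nat) (Y : nat -> set V) :
  compact T ->
  (forall n, (n0 <= n)%N ->
     [/\ closed (Y n), Y n `<=` T, Y n !=set0 & Y n.+1 `<=` Y n]) ->
  (forall e : R, 0 < e -> exists2 n, (n0 <= n)%N &
     forall a b, Y n a -> Y n b -> `|a - b| < e) ->
  exists x, \bigcap_(n in [set n | (n0 <= n)%N]) Y n = [set x].
Proof.
move=> Tc HY diam.
have mono n m : (n0 <= n)%N -> (n <= m)%N -> Y m `<=` Y n.
  move=> hn /subnK <-; elim: (m - n)%N => [//|k IH].
  have [_ _ _ step] := HY (k + n)%N (leq_trans hn (leq_addl _ _)).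
  exact: subset_trans step IH.
have /choice[y Hy] : forall k, exists z, Y (k + n0)%N z.
  by move=> k; have [_ _ [z Yz] _] := HY (k + n0)%N (leq_addl _ _); exists z.
have [x [_ xcl]] : T `&` cluster (y @ \oo) !=set0.
  apply: Tc; exists 0%N => // k _ /=.
  by have [_ YT _ _] := HY (k + n0)%N (leq_addl _ _); apply/YT/Hy.
exists x; apply/seteqP; split=> [z Yz|_ -> n hn] /=.
  apply/eqP; rewrite -subr_eq0 -normr_le0; apply/ler_addgt0Pr => e e0.
  rewrite add0r; have [n hn small] := diam e e0.
  apply/ltW/small; first exact: Yz.
  suff : closure (Y n) x by have [/closure_id <-] := HY n hn.
  move=> B Bx; apply: xcl => //.
  exists n => // k /= nk; apply: (mono n (k + n0)%N) => //.
  by rewrite (leq_trans nk) // leq_addr.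
suff : closure (Y n) x by have [/closure_id <-] := HY n hn.
move=> B Bx; apply: xcl => //.
exists n => // k /= nk; apply: (mono n (k + n0)%N) => //.
by rewrite (leq_trans nk) // leq_addr.
Qed.

(** * Unions of tiles *)

Lemma finite_bounded_int_cV d (S : set 'cV[int]_d) (N : nat) :
  (forall v i, S v -> `|v i 0| <= N%:Z) -> finite_set S.
Proof.
move=> SN.
(* Coordinates shifted by [N] range over [0..2N], so the finite type of columns with such entries
   covers [S]. *)
pose f (u : 'cV['I_(N + N).+1]_d) : 'cV[int]_d :=
  map_mx (fun k : 'I_(N + N).+1 => k%:Z - N%:Z) u.
apply: (@sub_finite_set _ _ (f @` setT)); last first.
  exact/finite_image/finite_finset.
move=> v Sv; exists (\col_i inord `|(v i 0 + N%:Z)%R|%N) => //.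
apply/colP => i; rewrite !mxE.
have := SN v i Sv; rewrite ler_norml => /andP[h1 h2].
have h : 0 <= v i 0 + N%:Z by rewrite addrC -lerBlDl sub0r.
rewrite inordK; last by rewrite ltnS -lez_nat gez0_abs // PoszD lerD2r.
by rewrite gez0_abs // addrK.
Qed.

Lemma exp_small (R : realType) (r C e : R) (n0 : nat) :
  0 < r -> r < 1 -> 0 <= C -> 0 < e -> exists2 n, (n0 <= n)%N & C * r ^+ n < e.
Proof.
move=> r0 r1 C0 e0.
have : `|r| < 1 by rewrite gtr0_norm.
(* Dividing by [C + 1] covers the case [C = 0]. *)
move/cvg_expr/cvgrPdist_lt => /(_ (e / (C + 1))).
rewrite divr_gt0 ?ltr_wpDl // => /(_ isT) [N _ HN].
exists (maxn n0 N); first exact: leq_maxl.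
have := HN _ (leq_maxr n0 N); rewrite /= sub0r normrN gtr0_norm ?exprn_gt0 //.
rewrite ltr_pdivlMr ?ltr_wpDl // => h; apply: le_lt_trans h.
by rewrite mulrC ler_wpM2l ?exprn_ge0 ?(ltW r0) // lerDl.
Qed.

Section TileUnion.
Context (R : realType) (d : nat) (A : 'M[int]_d) (D : set 'cV[int]_d).
Context (T : set 'cV[R]_d).
Let M : 'M[R]_d := map_mx intr A.

Lemma hata_vertices0 : hata_vertices A D 0 = [set 0].
Proof.
apply/seteqP; split=> [v [dg _ ->]|_ ->]; first by rewrite big_ord0.
by exists (fun=> 0); rewrite ?big_ord0 // => -[].
Qed.

(** Splitting off the digit of [A ^+ 0] leaves a sum from which one factor [A] can be pulled out. *)
Lemma hata_verticesS n :
  hata_vertices A D n.+1 = children A D (hata_vertices A D n).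
Proof.
have shift (dg : 'I_n -> 'cV[int]_d) :
    \sum_(k < n) A ^+ k.+1 *m dg k = A *m \sum_(k < n) A ^+ k *m dg k.
  by rewrite mulmx_sumr; apply: eq_bigr => k _; rewrite exprS -mulmxA.
apply/seteqP; split=> [v [dg Ddg ->]|_ [_ [dg Ddg ->]] [e De <-]].
  exists (\sum_(k < n) A ^+ k *m dg (lift ord0 k)).
    by exists (dg \o lift ord0) => // k; apply: Ddg.
  exists (dg ord0) => //.
  by rewrite big_ord_recl expr0 mul1mx addrC -shift.
(* The sequence [dg] with [e] put in front as the lowest digit. *)
exists (fun k => oapp dg e (unlift ord0 k)).
  by move=> k; case: unliftP => /=.
rewrite big_ord_recl expr0 mul1mx unlift_none /= addrC; congr (_ + _).
by rewrite -shift; apply: eq_bigr => k _; rewrite liftK.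
Qed.

Hypothesis Mu : M \in unitmx.

Lemma invmx_powS n (x : 'cV[R]_d) :
  invmx (M ^+ n.+1) *m (M *m x) = invmx (M ^+ n) *m x.
Proof.
have Mnu := unitmxX n Mu; have MSu := unitmxX n.+1 Mu.
rewrite -{1}[x](mulKVmx Mnu) (mulmxA M) -[M *m M ^+ n]/(M * M ^+ n) -exprS.
by rewrite mulKmx.
Qed.

Lemma map_child (v e : 'cV[int]_d) :
  map_mx intr (A *m v + e) = M *m map_mx intr v + map_mx intr e :> 'cV[R]_d.
Proof. by rewrite map_mxD map_mxM. Qed.

Hypothesis TE : linear_image M T = \bigcup_(e in D) translate T e.

(** Subdivision of a piece: [A^-n (T + v) = A^-(n+1) (A T + A v)], and [A T] is the union of the
    [T + e]. *)
Lemma tile_union_children n (U : set 'cV[int]_d) :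
  tile_union A T n.+1 (children A D U) = tile_union A T n U.
Proof.
apply/seteqP; split=> y.
  move=> [_ [v Uv [e De <-]] [_ [t Tt <-] <-]].
  have : linear_image M T (t + map_mx intr e).
    by rewrite TE; exists e => //; exists t.
  move=> [s Ts Ms]; exists v => //; exists (s + map_mx intr v).
    by exists s.
  by rewrite map_child addrCA -Ms addrC -mulmxDr invmx_powS.
move=> [v Uv [_ [s Ts <-] <-]].
have : linear_image M T (M *m s) by exists s.
rewrite TE => -[e De [t Tt Ht]].
exists (A *m v + e); first by exists v => //; exists e.
exists (t + map_mx intr (A *m v + e)); first by exists t.
by rewrite map_child addrCA Ht addrC -mulmxDr invmx_powS.
Qed.

Lemma tile_union_vertices n : tile_union A T n (hata_vertices A D n) = T.
Proof.
elim: n => [|n IH]; last by rewrite hata_verticesS tile_union_children.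
rewrite hata_vertices0 /tile_union bigcup_set1 expr0 invmx1.
apply/seteqP; split=> [_ [_ [t Tt <-] <-]|t Tt].
  by rewrite map_mx0 addr0 mul1mx.
by exists t; rewrite ?mul1mx //; exists t => //; rewrite map_mx0 addr0.
Qed.

Lemma tile_unionS n (U W : set 'cV[int]_d) :
  U `<=` W -> tile_union A T n U `<=` tile_union A T n W.
Proof. exact: bigcup_subset. Qed.

Lemma tile_unionU n (U W : set 'cV[int]_d) :
  tile_union A T n (U `|` W) = tile_union A T n U `|` tile_union A T n W.
Proof. exact: bigcup_setU. Qed.

Lemma tile_union_closed n (U : set 'cV[int]_d) :
  compact T -> finite_set U -> closed (tile_union A T n U).
Proof.
move=> Tc Uf; apply: closed_bigcup => // v _; apply: compact_closed.
  exact: norm_hausdorff.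
apply: continuous_compact.
  by apply: continuous_subspaceT => x; apply: mulmx_continuous.
apply: continuous_compact => //; apply: continuous_subspaceT => x.
exact: cvgD cvg_id (cvg_cst _).
Qed.

Lemma compact_norm_bound :
  compact T -> exists2 b : R, 0 <= b & forall x, T x -> `|x| <= b.
Proof.
move=> /compact_bounded[b [_ Hb]]; exists (`|b| + 1); first by rewrite addr_ge0.
by apply: Hb; rewrite (le_lt_trans (ler_norm b)) // ltrDl.
Qed.

(* The digit set is not assumed finite: finiteness comes from
   [A^-n (t + v) \in T] with [T] bounded. *)
Lemma hata_vertices_finite n :
  compact T -> T !=set0 -> finite_set (hata_vertices A D n).
Proof.
move=> Tc [t Tt]; have [b b0 Tb] := compact_norm_bound Tc.
(* Bounds [M ^+ n *m y - t] for [y] and [t] in [T], the form in which each vertex is written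
   below. *)
pose c : R := d%:R * `|M ^+ n| * b + b.
have c0 : 0 <= c by rewrite addr_ge0 ?mulr_ge0.
apply: (@finite_bounded_int_cV _ _ (Num.bound c)) => v i Vv.
rewrite -(ler_int R) intr_norm.
apply: le_trans (ltW (archi_boundP c0)).
have Ts : T (invmx (M ^+ n) *m (t + map_mx intr v)).
  rewrite -[X in X _](tile_union_vertices n); exists v => //.
  by exists (t + map_mx intr v) => //; exists t.
have -> : (v i ord0)%:~R =
    (M ^+ n *m (invmx (M ^+ n) *m (t + map_mx intr v)) - t) i ord0.
  by rewrite mulKVmx ?unitmxX // addrC addKr mxE.
apply: le_trans (mx_coord_norm_le _ _ _) _.
apply: le_trans (ler_normB _ _) _; apply: lerD; last exact: Tb.
apply: le_trans (mulmx_norm_le _ _ (mx_coord_norm_le (M ^+ n))) _ => //.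
by rewrite ler_wpM2l ?mulr_ge0 // Tb.
Qed.

(** An interior point of [T + v], scaled by [A^-n], is the witness: a piece of [W] containing it
    would make some other translate meet the interior of [T + v]. *)
Lemma tile_union_not_subset n (U W : set 'cV[int]_d) :
  T° !=set0 ->
  (forall z1 z2 : 'cV[int]_d, z1 <> z2 ->
     (translate T z1)° `&` translate T z2 = set0) ->
  U `&` W = set0 -> U !=set0 -> ~ tile_union A T n U `<=` tile_union A T n W.
Proof.
move=> [p pT] Tdisj UW [v Uv] UsubW.
have : tile_union A T n U (invmx (M ^+ n) *m (p + map_mx intr v)).
  exists v => //; exists (p + map_mx intr v) => //.
  by exists p => //; apply: interior_subset.
move/UsubW => [w Ww [_ [t Tt <-] Etw]].
have {}Etw : t + map_mx intr w = p + map_mx intr v.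
  by move/(congr1 (mulmx (M ^+ n))): Etw; rewrite !mulKVmx ?unitmxX.
have vw : v <> w.
  by move=> vw; have : set0 v by rewrite -UW; split=> //; rewrite vw.
have : set0 (p + map_mx intr v : 'cV[R]_d).
  rewrite -(Tdisj v w vw); split; last by exists t.
  (* Continuity of the inverse translation shows that [p + v] is interior to [T + v]. *)
  pose back (y : 'cV[R]_d) := y - map_mx intr v.
  have : nbhs (p + map_mx intr v) (back @^-1` T).
    have : back @ (p + map_mx intr v) --> p.
      rewrite -[X in _ --> X](addrK (map_mx intr v) p).
      exact: cvgB cvg_id (cvg_cst _).
    by apply; exact: pT.
  by apply: filterS => y Ty; exists (y - map_mx intr v) => //; rewrite subrK.
by [].
Qed.

(** Triangle inequality along the path: consecutive pieces share a point, and [size p] edges join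
    [(size p).+1] pieces. *)
Lemma path_dist n (delta : R) (p : seq 'cV[int]_d)
    (u : 'cV[int]_d) (a b : 'cV[R]_d) :
  let piece v := linear_image (invmx (M ^+ n)) (translate T v) in
  (forall v x y, piece v x -> piece v y -> `|x - y| <= delta) ->
  path (hata_edge A D T n) u p -> piece u a -> piece (last u p) b ->
  `|a - b| <= (size p).+1%:R * delta.
Proof.
move=> piece small; elim: p u a => [|w p IH] u a /=.
  by move=> _ ua ub; rewrite mul1r; apply: (small u).
move=> /andP[/asboolP[_ _ [z [uz wz]]] wp] ua lb.
rewrite -(subrK (invmx (M ^+ n) *m z) a) -addrA -natr1 mulrDl mul1r addrC.
apply: le_trans (ler_normD _ _) _; apply: lerD.
  by apply: (IH w) => //; exists z.
by apply: (small u) => //; exists z.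
Qed.

(** Connectedness only gives a walk of unknown length; once repetitions are removed it visits at
    most [K] pieces. *)
Lemma tile_union_diam n (W : set 'cV[int]_d) (K : nat) (delta : R) :
  0 <= delta ->
  (forall v x y, linear_image (invmx (M ^+ n)) (translate T v) x ->
     linear_image (invmx (M ^+ n)) (translate T v) y -> `|x - y| <= delta) ->
  W #<= `I_K -> induces_connected (hata_edge A D T n) W ->
  forall a b, tile_union A T n W a -> tile_union A T n W b ->
  `|a - b| <= K%:R * delta.
Proof.
move=> d0 small WK Wconn a b [u Wu ua] [v Wv vb].
have [p0 e_p0 lp0] := Wconn u v Wu Wv.
move: vb; rewrite -lp0; case: (shortenP e_p0) => p e_p p_uniq _ vb.
have Wp w : w \in u :: p -> W w.
  rewrite in_cons => /orP[/eqP->//|]; elim: (p) (u) e_p => // y q IH x /=.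
  move=> /andP[/and3P[_ /asboolP Wy _] yq]; rewrite in_cons => /orP[/eqP->//|].
  exact: IH yq.
have pK : (size p < K)%N.
  have Wfin : finite_set W by apply/finite_set_leP; exists K.
  apply: leq_trans (geq_card_fset_set WK).
  apply: (uniq_leq_size p_uniq) => w wp.
  by rewrite in_fset_set // inE; apply: Wp.
have : path (hata_edge A D T n) u p.
  by apply: sub_path e_p => x y /and3P[].
move=> ep; apply: le_trans (path_dist small ep ua vb) _.
by rewrite ler_wpM2r // ler_nat.
Qed.

(** A common point would be an edge from [W1] to [W3], that is, a path with two vertices that avoids
    [W2]. *)
Lemma separated_disjoint n (W1 W2 W3 : set 'cV[int]_d) :
  partition3 (hata_vertices A D n) W1 W2 W3 ->
  separates (hata_edge A D T n) W2 W1 W3 ->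
  tile_union A T n W1 `&` tile_union A T n W3 = set0.
Proof.
move=> [VE W12 W13 W23] sep.
apply/seteqP; split=> // y [[u W1u [_ [s Ts <-] <-]] [w W3w [_ [t Tt <-] Est]]].
have {}Est : t + map_mx intr w = s + map_mx intr u.
  by move/(congr1 (mulmx (M ^+ n))): Est; rewrite !mulKVmx ?unitmxX.
have uw : path (hata_edge A D T n) u [:: w].
  rewrite /= andbT; apply/asboolP; split.
  - by rewrite VE; left; left.
  - by rewrite VE; right.
  - by exists (s + map_mx intr u); split; [exists s|exists t].
have [x + W2x] := sep u [:: w] uw W1u W3w.
rewrite !inE => /orP[/eqP xu|/eqP xw].
  by have : set0 x by rewrite -W12; split=> //; rewrite xu.
by have : set0 x by rewrite -W23; split=> //; rewrite xw.
Qed.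

End TileUnion.

Theorem theorem4p2 (R : realType) (d : nat) (A : 'M[int]_d)
    (D : set 'cV[int]_d) (T : set 'cV[R]_d) (n0 : nat)
    (W1 W2 W3 : nat -> set 'cV[int]_d)
    (T_tile : Zd_tile A D T)
    (T_connected : connected T)
    (n0_gt0 : (0 < n0)%N)
    (W_partition : forall n, (n0 <= n)%N ->
       partition3 (hata_vertices A D n) (W1 n) (W2 n) (W3 n))
    (W_nonempty : forall n, (n0 <= n)%N ->
       [/\ W1 n !=set0, W2 n !=set0 & W3 n !=set0])
    (W2_connected : forall n, (n0 <= n)%N ->
       induces_connected (hata_edge A D T n) (W2 n))
    (W2_separates : forall n, (n0 <= n)%N ->
       separates (hata_edge A D T n) (W2 n) (W1 n) (W3 n))
    (W_children : forall n, (n0 <= n)%N ->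
       [/\ W1 n.+1 `<=` children A D (W1 n) `|` children A D (W2 n),
           W2 n.+1 `<=` children A D (W2 n)
         & W3 n.+1 `<=` children A D (W3 n) `|` children A D (W2 n)])
    (W2_bounded : exists K : nat, forall n, (n0 <= n)%N -> W2 n #<= `I_K) :
  exists x : 'cV[R]_d,
    \bigcap_(n in [set n | (n0 <= n)%N]) tile_union A T n (W2 n) = [set x]
    /\ cut_point T x.
Proof.
case: T_tile => Aexp _ T0 Tc TE Tint _ Tdisj.
have Mu := expanding_unitmx Aexp.
have [r [c [r0 r1 c0 contr]]] := expanding_contraction Aexp.
have [b b0 Tb] := compact_norm_bound Tc.
have [K WK] := W2_bounded.
pose Y (W : nat -> set 'cV[int]_d) n := tile_union A T n (W n).
have Wsub n : (n0 <= n)%N -> [/\ W1 n `<=` hata_vertices A D n,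
    W2 n `<=` hata_vertices A D n & W3 n `<=` hata_vertices A D n].
  by move=> hn; have [-> _ _ _] := W_partition n hn; split=> v Wv;
    [left; left|left; right|right].
have Ycl W n : W `<=` hata_vertices A D n -> closed (tile_union A T n W).
  move=> Wn; apply: tile_union_closed => //; apply: sub_finite_set Wn _.
  exact: (@hata_vertices_finite _ _ _ _ T).
have Ystep n : (n0 <= n)%N -> [/\ Y W1 n.+1 `<=` Y W1 n `|` Y W2 n,
    Y W2 n.+1 `<=` Y W2 n & Y W3 n.+1 `<=` Y W3 n `|` Y W2 n].
  move=> hn; have [W1s W2s W3s] := W_children n hn.
  (* With the unions of level [n] rewritten over children at level [n.+1], only inclusions of vertex
     sets remain. *)
  rewrite /Y -!(tile_union_children Mu TE n) -!tile_unionU.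
  by split; apply: tile_unionS.
have [x Dx] : exists x, \bigcap_(n in [set n | (n0 <= n)%N]) Y W2 n = [set x].
  apply: (nested_compact_singleton Tc) => [n hn|e e0].
    have [_ W2V _] := Wsub n hn; split.
    - exact: Ycl.
    - rewrite -[X in _ `<=` X](tile_union_vertices Mu TE n).
      exact: tile_unionS.
    - have [_ [v W2v] _] := W_nonempty n hn; have [t Tt] := T0.
      exists (invmx (map_mx intr A ^+ n) *m (t + map_mx intr v)), v => //.
      by exists (t + map_mx intr v) => //; exists t.
    - by have [] := Ystep n hn.
  (* There are at most [K] pieces, each of diameter at most [c * r ^+ n * (b + b)], since [b] bounds
     the norm on [T]. *)
  have [|n hn small] := exp_small n0 r0 r1 (C := K%:R * (c * (b + b))) _ e0.
    by rewrite !mulr_ge0 ?addr_ge0.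
  exists n => // a a' Ya Ya'; apply: le_lt_trans small.
  rewrite -mulrA.
  apply: (tile_union_diam _ _ (WK n hn) (W2_connected n hn)) => //.
    by rewrite !mulr_ge0 ?addr_ge0 ?exprn_ge0 ?(ltW r0).
  move=> v _ _ [_ [s Ts <-] <-] [_ [t Tt <-] <-].
  (* The translation by [v] cancels, so the contraction applies to [s - t]. *)
  rewrite -mulmxBr opprD addrACA subrr addr0; apply: le_trans (contr _ _) _.
  rewrite mulrAC ler_wpM2r ?exprn_ge0 ?(ltW r0) // ler_wpM2l //.
  by apply: le_trans (ler_normB _ _) _; rewrite lerD ?Tb.
exists x; split=> //; apply: cut_point_of_separation Ystep Dx _ _.
- move=> n hn; have [W1V W2V W3V] := Wsub n hn.
  rewrite /Y -!tile_unionU; split.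
  + by have [<- _ _ _] := W_partition n hn; rewrite tile_union_vertices.
  + exact: (separated_disjoint Mu (W_partition n hn) (W2_separates n hn)).
  + by apply: Ycl; rewrite subUset.
  + by apply: Ycl; rewrite subUset.
- have [_ W12 _ _] := W_partition n0 (leqnn _).
  by have [W1n _ _] := W_nonempty n0 (leqnn _); apply: tile_union_not_subset.
have [_ _ _ W23] := W_partition n0 (leqnn _); rewrite setIC in W23.
by have [_ _ W3n] := W_nonempty n0 (leqnn _); apply: tile_union_not_subset.
Qed.
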